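(* Let $G$ be a finite simple undirected graph with $\operatorname{diam}(G)=2$. Then $D_2(G)$ is disconnected if and only if $G$ has a spanning complete bipartite subgraph.
   Context: All graphs are finite, simple and undirected. $d(x,y)$ denotes the length of a shortest path between $x$ and $y$ in $G$, and $\operatorname{diam}(G)$ is the maximum distance between vertices of $G$ (so $\operatorname{diam}(G)=2$ implies that $G$ is connected). The $2$-distance graph $D_2(G)$ has vertex set $V(G)$, and two vertices are adjacent in $D_2(G)$ if and only if their distance in $G$ is exactly $2$. A spanning complete bipartite subgraph of $G$ is a (not necessarily induced) subgraph with vertex set $V(G)$ for which $V(G)$ is the disjoint union of two non-empty sets $A,B$ and whose edges are exactly all pairs $ab$ with $a\in A$, $b\in B$. *)

(* Defs.v *)
From mathcomp Require Import all_boot.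

Set Implicit Arguments.
Unset Strict Implicit.
Unset Printing Implicit Defensive.

(* A finite simple undirected graph is given by its vertex type [T : finType]
   and its adjacency relation [e : rel T], symmetric and irreflexive. *)
Section Graphs.

Variables (T : finType) (e : rel T).

(* A path has pairwise distinct vertices; its length is its number of edges. *)
Definition has_path (x y : T) (n : nat) : bool :=
  [exists p : n.-tuple T,
    [&& path e x p, uniq (x :: p) & last x p == y]].

(* The least length of a path from x to y, [None] if there is no such path.
   Lengths below #|T| suffice, as the n + 1 vertices of a path are distinct. *)
Definition dist (x y : T) : option nat :=
  ohead [seq n <- iota 0 #|T| | has_path x y n].

(* [None] when G is disconnected, i.e. when some distance is infinite. *)
Definition diam : option nat :=
  if [forall x, forall y, dist x y != None]
  then Some (\max_(x : T) \max_(y : T) odflt 0 (dist x y))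
  else None.

Definition D2 : rel T := [rel x y | dist x y == Some 2].

Definition connected_graph : Prop := forall x y : T, connect e x y.

End Graphs.

Definition complete_bipartite (T : finType) (A B : {set T}) : rel T :=
  [rel x y | (x \in A) && (y \in B) || (x \in B) && (y \in A)].

Definition has_spanning_complete_bipartite (T : finType) (e : rel T) : Prop :=
  exists A B : {set T},
    [/\ A != set0, B != set0, A :|: B = [set: T], A :&: B = set0
      & subrel (complete_bipartite A B) e].

Section DistSpec.

Variables (T : finType) (e : rel T).

Lemma has_pathP (x y : T) (n : nat) :
  reflect (exists p : seq T,
             [/\ path e x p, uniq (x :: p), last x p = y & size p = n])
          (has_path e x y n).
Proof.
apply: (iffP existsP) => [[p /and3P[ep up /eqP lp]]|[p [ep up lp sp]]].
  by exists p; split=> //; rewrite size_tuple.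
have sz : size p == n by apply/eqP.
by exists (Tuple sz); apply/and3P; split=> //=; apply/eqP.
Qed.

Lemma has_path_lt (x y : T) (n : nat) : has_path e x y n -> n < #|T|.
Proof.
by case/has_pathP=> p [_ up _ <-]; rewrite -[(size p).+1]/(size (x :: p))
  -(card_uniqP up) max_card.
Qed.

Lemma dist_SomeP (x y : T) (n : nat) :
  dist e x y = Some n <->
  has_path e x y n /\ (forall m, has_path e x y m -> n <= m).
Proof.
rewrite /dist; set s := filter _ _.
have in_s m : (m \in s) = has_path e x y m.
  rewrite mem_filter mem_iota add0n leq0n /=.
  by apply/andb_idr; apply: has_path_lt.
have srt : sorted leq s by apply: sorted_filter (iota_sorted _ _); exact: leq_trans.
clearbody s; case: s in_s srt => [|k s] in_s srt /=.
  by split=> // -[]; rewrite -in_s.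
have kmin m : has_path e x y m -> k <= m.
  rewrite -in_s inE => /predU1P[->//|ms].
  by move: srt => /= /(order_path_min leq_trans)/allP/(_ m ms).
have hk : has_path e x y k by rewrite -in_s mem_head.
split=> [[<-]|[hn nmin]]; first by split.
by congr Some; apply/eqP; rewrite eqn_leq kmin //= nmin.
Qed.

Lemma dist_NoneP (x y : T) : dist e x y = None <-> ~~ connect e x y.
Proof.
split=> [dN|nc].
  apply/negP=> /connectP[p ep def_y]; move: dN; rewrite {y}def_y.
  case/shortenP: ep => p' ep' up' _ dN.
  have h : has_path e x (last x p') (size p') by apply/has_pathP; exists p'.
  move: dN; rewrite /dist; set s := filter _ _.
  have : size p' \in s by rewrite mem_filter h mem_iota /= (has_path_lt h).
  by case: s.
case E: (dist e x y) => [n|//]; have [/has_pathP[p [ep _ lp _]] _] := (dist_SomeP x y n).1 E.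
by case/negP: nc; apply/connectP; exists p.
Qed.

End DistSpec.

(* Main.v *)
(* When diam(G) = 2, D_2(G) is the complement of G. A spanning complete bipartite
   subgraph of G with parts A, B says exactly that no edge of the complement
   joins A to B, i.e. that A is a proper non-empty union of components of D_2(G). *)
Require Import Defs.
From mathcomp Require Import all_boot.

Lemma has_path0 (T : finType) (e : rel T) (x y : T) :
  has_path e x y 0 = (x == y).
Proof.
apply/has_pathP/eqP => [[p [_ _ <- /size0nil ->]] //|<-].
by exists [::].
Qed.

(** Irreflexivity gives the distinct endpoints that [uniq] demands of a one-edge path. *)
Lemma has_path1 (T : finType) (e : rel T) (x y : T) :
  irreflexive e -> has_path e x y 1 = e x y.
Proof.
move=> e_irr; apply/has_pathP/idP => [[[|z [|? ?]] [] //=]|exy].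
  by rewrite andbT => ? _ <-.
exists [:: y]; split=> //=; first by rewrite exy.
by rewrite !inE !andbT; apply: contraTneq exy => ->; rewrite e_irr.
Qed.

Lemma dist_diam_leq (T : finType) (e : rel T) (d : nat) (x y : T) :
  diam e = Some d -> exists2 n, dist e x y = Some n & n <= d.
Proof.
rewrite /diam; case: ifP => // /forallP/(_ x)/forallP/(_ y) dxy [<-].
case E: (dist e x y) dxy => [n|//] _; exists n => //.
apply: (bigmax_sup x) => //; apply: (bigmax_sup y) => //.
by rewrite E.
Qed.

(** Every distance is at most 2, and 0 and 1 are ruled out exactly by the absence of paths of these
    lengths, that is, by distinctness and non-adjacency. *)
Lemma D2_diam2 (T : finType) (e : rel T) (x y : T) :
  irreflexive e -> diam e = Some 2 -> D2 e x y = (x != y) && ~~ e x y.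
Proof.
move=> e_irr e_diam; rewrite -(@has_path0 T e) -(@has_path1 T e) // /D2 /=.
have [n dn le_n2] := @dist_diam_leq T e 2 x y e_diam; rewrite dn.
have [hn nmin] := (dist_SomeP e x y n).1 dn.
apply/eqP/andP => [[n2]|[h0 h1]].
  by split; apply/negP => /nmin; rewrite n2.
by case: n hn le_n2 h0 h1 {dn nmin} => [|[|[|]]] // ->.
Qed.

Theorem theorem2p1 (T : finType) (e : rel T)
    (e_sym : symmetric e) (e_irr : irreflexive e)
    (e_diam : diam e = Some 2) :
  ~ connected_graph (D2 e) <-> has_spanning_complete_bipartite e.
Proof.
have D2E x y : D2 e x y = (x != y) && ~~ e x y by apply: D2_diam2.
have D2_sym : connect_sym (D2 e).
  by apply: sym_connect_sym => x y; rewrite !D2E eq_sym e_sym.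
split=> [disc|[A [B [/set0Pn[a aA] /set0Pn[b bB] AUB AIB AB_e]]] conn].
  have [/forallP all_c|] :=
    boolP [forall x, forall y, connect (D2 e) x y].
    by case: disc => x y; apply: (forallP (all_c x)).
  rewrite negb_forall => /existsP[x]; rewrite negb_forall => /existsP[y nxy].
  (* One part is the component of [x] in [D2 e]; [y] lies outside it. *)
  pose A := [set z | connect (D2 e) x z].
  have A_e u v : u \in A -> v \in ~: A -> e u v.
    (* If [u] and [v] were non-adjacent in G, they would be equal or joined in [D2 e], putting [v]
       in the component. *)
    rewrite !inE => xu; apply: contraR => nuv.
    have [<-//|neq_uv] := eqVneq u v.
    by apply: connect_trans xu (connect1 _); rewrite D2E neq_uv.
  exists A, (~: A); split; rewrite ?setUCr ?setICr //.
  - by apply/set0Pn; exists x; rewrite inE.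
  - by apply/set0Pn; exists y; rewrite !inE.
  - by move=> u v /orP[] /andP[uP vP]; [|rewrite e_sym]; apply: A_e.
have closedA : closed (D2 e) (mem A).
  (* By [D2_sym] it suffices that no [D2 e] edge leaves [A]: it would end in [B], hence be an edge
     of G. *)
  apply: intro_closed => // u v; rewrite D2E => /andP[_ nuv] uA.
  apply: contraNT nuv => vNA; apply: AB_e; rewrite /complete_bipartite /= uA.
  by have := in_setT v; rewrite -AUB inE (negPf vNA) /= => ->.
(* Connectivity then forces [b] into [A] as well, against disjointness. *)
have := closed_connect closedA (conn a b); rewrite /= aA => /esym bA.
by have := in_set0 b; rewrite -AIB inE bA bB.
Qed.
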